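(* Let $\lambda_1\in\mathbb{R}$ with $0<|\lambda_1|<1$ and $h\in\mathbb{R}_{>0}$. Consider the system $x[k+1]=Ax[k]+w[k]$ with $A=\mathrm{diag}(\lambda_1,0,0)$, $W=I_{3\times3}$, and three candidate sensors with scalar measurements $y_i[k]=C_ix[k]+v_i[k]$, where $C_1=[1\ h\ h]$, $C_2=[1\ 0\ h]$, $C_3=[0\ 1\ 1]$, and measurement noise covariance $V=\mathbf{0}_{3\times3}$. Each sensor has cost $1$ and the budget is $2$. Let $\Sigma_{opt}=\Sigma(\mu^* )$ where $\mu^*$ minimizes $\mathrm{trace}(\Sigma(\mu))$ over all $\mu\in\{0,1\}^3$ with $\mu_1+\mu_2+\mu_3\le 2$, and let $\Sigma_{gre}$ be $\Sigma(\mu)$ for the selection produced by the greedy algorithm with budget $p_s=2$. Then $r_{gre}(\Sigma)=\mathrm{trace}(\Sigma_{gre})/\mathrm{trace}(\Sigma_{opt})$ satisfies $$\lim_{h\to\infty} r_{gre}(\Sigma)=\frac{2}{3}+\frac{1}{3(1-\lambda_1^2)}.$$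
   Context: For a selection $\mu\in\{0,1\}^3$, $C(\mu)$ stacks the rows $C_i$ with $\mu_i=1$, and $V(\mu)=\mathbf{0}$. Since $A$ is stable, $\Sigma(\mu)$ is the limit as $k\to\infty$ of the a priori error covariance $\Sigma_{k|k-1}(\mu)$ of the Kalman filter using the selected sensors; it satisfies $\Sigma(\mu)=A\Sigma(\mu)A^T+W-A\Sigma(\mu)C(\mu)^T(C(\mu)\Sigma(\mu)C(\mu)^T)^{-1}C(\mu)\Sigma(\mu)A^T$, with the inverse interpreted as a pseudo-inverse when singular. The greedy algorithm with budget $p_s$ starts with $\mathcal{S}=\emptyset$ and, for $p_s$ iterations, adds to $\mathcal{S}$ a sensor $j\notin\mathcal{S}$ minimizing $\mathrm{trace}(\Sigma(\mathcal{S}\cup\{j\}))$, where $\Sigma(\mathcal{S})$ denotes $\Sigma(\mu)$ for the indicator vector $\mu$ of $\mathcal{S}$. *)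

(* Defs.v *)
From HB Require Import structures.
From mathcomp Require Import all_boot all_order all_algebra.
From mathcomp Require Import all_classical all_reals all_analysis.
From Stdlib Require Import ClassicalEpsilon.
Set Implicit Arguments. Unset Strict Implicit. Unset Printing Implicit Defensive.
Import Order.TTheory GRing.Theory Num.Theory numFieldNormedType.Exports.
Local Open Scope ring_scope.

Section Defs.
Variable R : realType.

Definition penrose m (M : 'M[R]_m) (G : 'M[R]_m) : Prop :=
  [/\ M *m G *m M = M, G *m M *m G = G,
      (M *m G)^T = M *m G & (G *m M)^T = G *m M].

(* Moore-Penrose pseudo-inverse (exists and is unique for real matrices). *)
Definition pinv m (M : 'M[R]_m) : 'M[R]_m :=
  epsilon (inhabits 0) (penrose M).

Definition psd n (M : 'M[R]_n) : Prop :=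
  M^T = M /\ forall v : 'rV[R]_n, 0 <= (v *m M *m v^T) 0 0.

Definition Csel p n (C : 'M[R]_(p, n)) (S : {set 'I_p}) : 'M[R]_(#|S|, n) :=
  \matrix_(i < #|S|, j < n) C (enum_val i) j.

Definition Vsel p (V : 'M[R]_p) (S : {set 'I_p}) : 'M[R]_#|S| :=
  \matrix_(i < #|S|, j < #|S|) V (enum_val i) (enum_val j).

(* One step of the a priori error covariance recursion of the Kalman filter:
   Sigma_{k+1|k} = A S A^T + W - A S C^T (C S C^T + V)^+ C S A^T. *)
Definition kalman_step n q (A W : 'M[R]_n) (C : 'M[R]_(q, n)) (V : 'M[R]_q)
  (S : 'M[R]_n) : 'M[R]_n :=
  A *m S *m A^T + W
  - A *m S *m C^T *m pinv (C *m S *m C^T + V) *m C *m S *m A^T.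

(* Sigma(S) = lim_{k -> oo} Sigma_{k|k-1}(S), with Sigma_{0|-1} = Pi0 (entrywise limit). *)
Definition Sigma n p (A W : 'M[R]_n) (C : 'M[R]_(p, n)) (V : 'M[R]_p)
  (Pi0 : 'M[R]_n) (S : {set 'I_p}) : 'M[R]_n :=
  \matrix_(i, j) limn (fun k : nat =>
     (iter k (kalman_step A W (Csel C S) (Vsel V S)) Pi0) i j).

(* greedy algorithm with objective f and budget ps: the possible outputs
   (any tie-breaking among minimizers is allowed) *)
Definition greedy_step p (f : {set 'I_p} -> R) (S S' : {set 'I_p}) : Prop :=
  exists j, j \notin S /\ S' = j |: S /\
    forall j', j' \notin S -> f (j |: S) <= f (j' |: S).

Fixpoint greedy_output p (f : {set 'I_p} -> R) (ps : nat) (S : {set 'I_p}) : Prop :=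
  match ps with
  | 0 => S = finset.set0
  | ps'.+1 => exists S', greedy_output f ps' S' /\ greedy_step f S' S
  end.

(* S minimizes f among selections of cardinality at most budget
   (all costs equal to 1). *)
Definition is_opt p (f : {set 'I_p} -> R) (budget : nat) (S : {set 'I_p}) : Prop :=
  (#|S| <= budget)%N /\ forall S' : {set 'I_p}, (#|S'| <= budget)%N -> f S <= f S'.

End Defs.

Definition Aex (R : realType) (lam : R) : 'M[R]_3 :=
  \matrix_(i, j) (if (i == j) && (i == 0) then lam else 0).

Definition Cex (R : realType) (h : R) : 'M[R]_3 :=
  \matrix_(i < 3, j < 3)
    nth (0 : R) (nth [::] [:: [:: 1; h; h]; [:: 1; 0; h]; [:: 0; 1; 1]] i) j.

(* Main.v *)
(** Only the entry (0,0) of the error covariance propagates, so from the first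
    step on the covariance is [diag(s, 1, 1)] with [s' = 1 + lam^2 P], [P] being
    the a posteriori variance of [x_1].  Each selection gives [P = 0] or
    [P = s / (1 + r s)], where [r] is the precision of the information on [x_1]:
    [r = 0] for the empty selection and {3}, [1/(2h^2)] for {1}, [1/h^2] for {2}
    and {1,2}, [2/h^2] for {2,3}; and [P = 0] for {1,3} because [y_1 - h y_3 = x_1].
    The scalar recursion is a contraction on [s >= 1] whose fixed point is
    strictly decreasing in [r], so the greedy algorithm picks sensor 2, then
    sensor 3, while {1,3} attains the lower bound 3 on the trace.  As
    [h -> oo], [r = 2/h^2 -> 0] and the fixed point for {2,3} tends to
    [1 / (1 - lam^2)]. *)

Require Import Defs.
From HB Require Import structures.
From mathcomp Require Import all_boot all_order all_algebra.
From mathcomp Require Import all_classical all_reals all_analysis.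
From mathcomp Require Import ring lra.
From Stdlib Require Import ClassicalEpsilon.
Set Implicit Arguments. Unset Strict Implicit. Unset Printing Implicit Defensive.
Import Order.TTheory GRing.Theory Num.Theory numFieldNormedType.Exports.
Local Open Scope ring_scope.
Local Open Scope classical_set_scope.

(** * The Moore-Penrose inverse and the noiseless measurement update *)

Section MoorePenrose.
Variable R : realType.

(** If [v B B^T = 0], the squared norm of [v B] vanishes, hence so does [v]. *)
Lemma gram_unitmx m n (B : 'M[R]_(m, n)) : row_free B -> B *m B^T \in unitmx.
Proof.
move=> Bfree; rewrite -row_free_unit; apply/row_freeP.
suff: row_free (B *m B^T) by move/row_freeP.
rewrite -kermx_eq0; apply/eqP/row_matrixP => i; rewrite row0.
set v := row i _.
have vBB : v *m (B *m B^T) = 0 by rewrite /v -row_mul mulmx_ker row0.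
have vB0 : v *m B = 0.
  apply/rowP => j; rewrite !mxE; apply/eqP; rewrite -sqrf_eq0; apply/eqP.
  have /matrixP/(_ 0 0) : (v *m B) *m (v *m B)^T = 0.
    by rewrite trmx_mul mulmxA -(mulmxA v) vBB mul0mx.
  rewrite !mxE => /eqP; rewrite psumr_eq0; last first.
    by move=> k _; rewrite !mxE -expr2 sqr_ge0.
  by move=> /allP/(_ j (mem_index_enum _)); rewrite !mxE -expr2 => /eqP.
by apply/eqP; rewrite -(mulmx_free_eq0 _ Bfree) vB0.
Qed.

(* For a full-rank factorization, [(B D)^+ = D^T (D D^T)^-1 (B^T B)^-1 B^T]. *)
Lemma penrose_factor m r (B : 'M[R]_(m, r)) (D : 'M[R]_(r, m)) :
  row_free B^T -> row_free D -> exists G, penrose (B *m D) G.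
Proof.
move=> /gram_unitmx; rewrite trmxK => uB /gram_unitmx uD.
pose E := invmx (D *m D^T); pose F := invmx (B^T *m B).
have DE : D *m D^T *m E = 1%:M by exact: mulmxV.
have FB : F *m (B^T *m B) = 1%:M by exact: mulVmx.
have Esym : E^T = E by rewrite /E trmx_inv trmx_mul trmxK.
have Fsym : F^T = F by rewrite /F trmx_inv trmx_mul trmxK.
have MG : (B *m D) *m (D^T *m E *m (F *m B^T)) = B *m F *m B^T.
  by rewrite -!mulmxA (mulmxA D) (mulmxA _ E) DE mul1mx.
have GM : (D^T *m E *m (F *m B^T)) *m (B *m D) = D^T *m E *m D.
  by rewrite -!mulmxA (mulmxA B^T) (mulmxA F) FB mul1mx.
exists (D^T *m E *m (F *m B^T)); split.
- by rewrite MG -!mulmxA (mulmxA B^T) (mulmxA F) FB mul1mx.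
- rewrite GM -!mulmxA; congr (_ *m (_ *m _)).
  by rewrite (mulmxA D) (mulmxA _ E) DE mul1mx.
- by rewrite MG !trmx_mul trmxK Fsym mulmxA.
- by rewrite GM !trmx_mul trmxK Esym mulmxA.
Qed.

(** Every matrix has a rank factorization, so the [epsilon] in [pinv] picks a genuine
    pseudo-inverse. *)
Lemma penrose_exists m (M : 'M[R]_m) : exists G, penrose M G.
Proof.
rewrite -(mulmx_base M); apply: penrose_factor; last exact: row_base_free.
by rewrite /row_free mxrank_tr; exact: col_base_full.
Qed.

Lemma pinvP m (M : 'M[R]_m) : penrose M (Defs.pinv M).
Proof. by rewrite /Defs.pinv; apply: epsilon_spec; exact: penrose_exists. Qed.

(** The projections [M G] and [G M] are the same for every inverse, so
    [G = G M G = H M G = H M H = H]. *)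
Lemma penrose_uniq m (M G H : 'M[R]_m) : penrose M G -> penrose M H -> G = H.
Proof.
move=> [g1 g2 g3 g4] [h1 h2 h3 h4].
have MHG : M *m H = M *m G.
  by rewrite -h3 -{1}g1 -(mulmxA (M *m G)) trmx_mul h3 g3 !mulmxA h1.
have GHM : G *m M = H *m M.
  by rewrite -g4 -{1}h1 -(mulmxA M) mulmxA trmx_mul g4 h4 -!mulmxA (mulmxA M) g1.
by rewrite -g2 GHM -mulmxA -MHG mulmxA h2.
Qed.

Lemma pinv_sym m (M : 'M[R]_m) : M^T = M -> (Defs.pinv M)^T = Defs.pinv M.
Proof.
move=> Msym; have [g1 g2 g3 g4] := pinvP M.
set G := Defs.pinv M in g1 g2 g3 g4 *.
have MGt : M *m G^T = G *m M by rewrite -g4 trmx_mul Msym.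
have GtM : G^T *m M = M *m G by rewrite -g3 trmx_mul Msym.
apply: (@penrose_uniq _ M); last exact: pinvP.
split.
- by rewrite -[in RHS]Msym -[in RHS]g1 !trmx_mul Msym mulmxA.
- by rewrite -[in RHS]g2 !trmx_mul Msym mulmxA.
- by rewrite trmx_mul trmxK Msym MGt.
- by rewrite trmx_mul trmxK Msym GtM.
Qed.

(** Error covariance after a measurement update with [V = 0]. *)
Definition posterior n q (C : 'M[R]_(q, n)) (S : 'M[R]_n) : 'M[R]_n :=
  S - S *m C^T *m Defs.pinv (C *m S *m C^T) *m C *m S.

(* With the gain [K = S C^T M^+], [M = C S C^T], the posterior covariance equals
   the manifestly nonnegative [(1 - K C) S (1 - K C)^T]. *)
Lemma posterior_ge0 n q (C : 'M[R]_(q, n)) (S : 'M[R]_n) (u : 'rV[R]_n) :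
  psd S -> 0 <= (u *m posterior C S *m u^T) 0 0.
Proof.
move=> [Ssym Sge0]; rewrite /posterior.
set M := C *m S *m C^T.
have Msym : M^T = M by rewrite /M !trmx_mul trmxK Ssym mulmxA.
have Gsym := pinv_sym Msym; have [_ GMG _ _] := pinvP M.
set G := Defs.pinv M in Gsym GMG *.
pose K := S *m C^T *m G.
suff -> : S - S *m C^T *m G *m C *m S = (1%:M - K *m C) *m S *m (1%:M - K *m C)^T.
  by rewrite !mulmxA -mulmxA -trmx_mul; exact: Sge0.
have KT : K^T = G *m C *m S by rewrite /K !trmx_mul trmxK Gsym Ssym mulmxA.
have KMK : K *m M *m K^T = K *m C *m S.
  have KMG : K *m M *m G = K.
    by rewrite /K -(mulmxA _ G M) -(mulmxA _ (G *m M)) GMG.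
  by rewrite KT -(mulmxA G) (mulmxA (K *m M)) KMG mulmxA.
rewrite linearB /= trmx1 trmx_mul mulmxBr mulmx1 mulmxBl mul1mx mulmxBl.
have -> : K *m C *m S *m (C^T *m K^T) = K *m C *m S by rewrite -[RHS]KMK /M !mulmxA.
by rewrite KT /K !mulmxA subrr subr0.
Qed.

(* Orthogonality principle: the estimator [K] of [u x] is optimal when its error
   is uncorrelated with the measurements. *)
Lemma posterior_gain n q (C : 'M[R]_(q, n)) (S : 'M[R]_n) (u : 'rV[R]_n)
    (K : 'rV[R]_q) :
  S^T = S -> (u - K *m C) *m S *m C^T = 0 ->
  u *m posterior C S *m u^T = (u - K *m C) *m S *m u^T.
Proof.
move=> Ssym; rewrite !mulmxBl => /eqP; rewrite subr_eq0 => /eqP uSC.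
rewrite /posterior mulmxBr mulmxBl; congr (_ - _).
set M := C *m S *m C^T; have [MGM _ _ _] := pinvP M.
set G := Defs.pinv M in MGM *.
have uSC' : u *m S *m C^T = K *m M by rewrite uSC /M !mulmxA.
have CSu : C *m S *m u^T = M *m K^T.
  by have := congr1 trmx uSC'; rewrite /M !trmx_mul !trmxK Ssym !mulmxA.
have CSu' p (X : 'M[R]_(p, q)) : X *m C *m S *m u^T = X *m (M *m K^T).
  by rewrite -CSu !mulmxA.
rewrite !mulmxA uSC' !CSu' (mulmxA _ M) -(mulmxA K M) -(mulmxA K _ M) MGM.
by rewrite -mulmxA.
Qed.

End MoorePenrose.

(** * The scalar Riccati recursion and its fixed point *)

Section ScalarRiccati.
Variable R : realType.
Implicit Types q r s L : R.

(** For [s > 0], [s / (1 + r s)] is the inverse of [1/s + r]: precisions add. *)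
Definition riccati q r s := 1 + q * (s / (1 + r * s)).

Definition riccati_fixpoint q r L := 1 <= L /\ riccati q r L = L.

Lemma riccati_ge1 q r s : 0 <= q -> 0 <= r -> 1 <= s -> 1 <= riccati q r s.
Proof.
move=> q0 r0 s1; rewrite /riccati lerDl mulr_ge0// divr_ge0//; first lra.
by rewrite addr_ge0// mulr_ge0//; lra.
Qed.

(* [L] is the positive root of [r L^2 + (1 - r - q) L - 1 = 0], written with the
   radical in the denominator so that [r = 0] is not exceptional. *)
Lemma riccati_fixpoint_exists q r :
  0 <= q < 1 -> 0 <= r -> exists L, riccati_fixpoint q r L.
Proof.
move=> /andP[q0 q1] r0.
pose b := 1 - r - q; pose t := Num.sqrt (b ^+ 2 + 4 * r).
have D0 : 0 <= b ^+ 2 + 4 * r by rewrite addr_ge0 ?sqr_ge0 ?mulr_ge0.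
have tt : t ^+ 2 = b ^+ 2 + 4 * r by rewrite sqr_sqrtr.
have t0 : 0 <= t by exact: sqrtr_ge0.
have d0 : 0 < b + t.
  (* If [b <= 0], then [r >= 1 - q > 0], so [t^2 > b^2] and [t > -b]. *)
  have [b0|b0] := ltP 0 b; first lra.
  have r1 : 0 < r by rewrite /b in b0; lra.
  nra.
pose L := 2 / (b + t).
have LE : L * (b + t) = 2 by rewrite /L divfK// gt_eqF.
have L0 : 0 < L by rewrite divr_gt0.
have root : r * L ^+ 2 + b * L - 1 = 0.
  suff : (r * L ^+ 2 + b * L - 1) * (b + t) ^+ 2 = 0.
    by move/eqP; rewrite mulf_eq0 expf_eq0 /= (gt_eqF d0) orbF => /eqP.
  have -> : (r * L ^+ 2 + b * L - 1) * (b + t) ^+ 2 =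
    r * (L * (b + t)) ^+ 2 + b * (L * (b + t)) * (b + t) - (b + t) ^+ 2 by ring.
  by rewrite LE (sqrrD b) tt; ring.
have rL : 0 <= r * L by rewrite mulr_ge0// ltW.
have fix_L : riccati q r L = L.
  rewrite /riccati; apply/eqP; rewrite -subr_eq0.
  have -> : 1 + q * (L / (1 + r * L)) - L = - (r * L ^+ 2 + b * L - 1) / (1 + r * L).
    by rewrite /b; field; apply: lt0r_neq0; lra.
  by rewrite root oppr0 mul0r.
exists L; split => //; rewrite -fix_L /riccati lerDl mulr_ge0// divr_ge0 ?ltW//.
by lra.
Qed.

(** The difference quotient of [s / (1 + r s)] is [1 / ((1 + r s) (1 + r t))], at most 1. *)
Lemma riccati_contract q r s t : 0 <= q -> 0 <= r -> 1 <= s -> 1 <= t ->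
  `|riccati q r s - riccati q r t| <= q * `|s - t|.
Proof.
move=> q0 r0 s1 t1.
have rs : 0 <= r * s by rewrite mulr_ge0//; lra.
have rt : 0 <= r * t by rewrite mulr_ge0//; lra.
have -> : riccati q r s - riccati q r t =
    q * ((s - t) / ((1 + r * s) * (1 + r * t))).
  by rewrite /riccati; field; rewrite !lt0r_neq0//; lra.
rewrite normrM (ger0_norm q0) ler_wpM2l// normrM ler_piMr//.
have d1 : 1 <= (1 + r * s) * (1 + r * t) by nra.
by rewrite ger0_norm ?invr_ge0 ?invf_le1//; lra.
Qed.

Lemma riccati_cvg q r L (u : R^nat) : 0 <= q < 1 -> 0 <= r ->
  riccati_fixpoint q r L -> 1 <= u 0%N ->
  (forall k, u k.+1 = riccati q r (u k)) -> u @ \oo --> L.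
Proof.
move=> /andP[q0 q1] r0 [L1 fixL] u0 uS.
have u1 k : 1 <= u k by elim: k => // k IH; rewrite uS riccati_ge1.
have bound k : `|u k - L| <= `|u 0%N - L| * q ^+ k.
  elim: k => [|k IH]; first by rewrite expr0 mulr1.
  rewrite uS -{1}fixL; apply: le_trans (riccati_contract q0 r0 (u1 k) L1) _.
  by rewrite exprS mulrCA ler_wpM2l.
have geo : (fun k => `|u 0%N - L| * q ^+ k) @ \oo --> (0 : R).
  rewrite -[X in _ --> X](mulr0 `|u 0%N - L|); apply: cvgM; first exact: cvg_cst.
  by apply: cvg_expr; rewrite ger0_norm.
apply/subr_cvg0/norm_cvg0P.
apply: (@squeeze_cvgr _ _ _ _ (fun=> 0) (fun k => `|u 0%N - L| * q ^+ k)) => //.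
- by near=> k; rewrite normr_ge0 bound.
- exact: cvg_cst.
Unshelve. all: by end_near. Qed.

(* At a fixed point, [1 = 1 / L + q / (1 + r L)], whose right-hand side decreases
   in both [L] and [r]. *)
Lemma riccati_fixpoint_lt q r1 r2 L1 L2 : 0 < q -> 0 <= r1 -> r1 < r2 ->
  riccati_fixpoint q r1 L1 -> riccati_fixpoint q r2 L2 -> L2 < L1.
Proof.
move=> q0 r10 r12 [L11 fix1] [L21 fix2]; rewrite ltNge; apply/negP => L12.
have inv_form r L : 0 <= r -> 1 <= L -> riccati q r L = L ->
    1 = L^-1 + q / (1 + r * L).
  move=> r0 L0 fixL.
  have rL : 0 <= r * L by rewrite mulr_ge0//; lra.
  rewrite -[LHS](@divff _ L) ?gt_eqF//; last lra.
  rewrite -{1}fixL /riccati; field.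
  by rewrite !lt0r_neq0//; lra.
have e1 := inv_form _ _ r10 L11 fix1.
have r20 : 0 <= r2 by lra.
have e2 := inv_form _ _ r20 L21 fix2.
have : L2^-1 <= L1^-1 by rewrite lef_pV2 ?posrE; lra.
have : q / (1 + r2 * L2) < q / (1 + r1 * L1).
  by rewrite ltr_pM2l// ltf_pV2 ?posrE; nra.
by lra.
Qed.

(** With [c = (1 - q)^-1] and [e = L^2 / (1 + r L) <= c^2], the fixed-point equation becomes
    [c - L = c q r e], a gap of order [r]. *)
Lemma riccati_fixpoint_near0 q r L : 0 <= q < 1 -> 0 <= r ->
  riccati_fixpoint q r L ->
  (1 - q)^-1 - r * (1 - q)^-1 ^+ 3 <= L <= (1 - q)^-1.
Proof.
move=> /andP[q0 q1] r0 [L1 fixL].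
have d : 0 < 1 - q by lra.
have rL : 0 <= r * L by rewrite mulr_ge0//; lra.
set c := (1 - q)^-1; have c0 : 0 < c by rewrite invr_gt0.
have cE : c * (1 - q) = 1 by rewrite mulVf// gt_eqF.
pose e := L ^+ 2 / (1 + r * L).
have e0 : 0 <= e by rewrite divr_ge0 ?sqr_ge0//; lra.
have gap : c - L = c * q * r * e.
  have : (1 - q) * L = 1 - q * r * e.
    have := fixL; rewrite /riccati => fixL'.
    rewrite mulrBl mul1r -{1}fixL' /e; field.
    by apply: lt0r_neq0; lra.
  move=> h; have -> : L = c * ((1 - q) * L) by rewrite mulrA cE mul1r.
  by rewrite h; ring.
have Lc : L <= c.
  by rewrite -subr_ge0 gap; apply/mulr_ge0/e0/mulr_ge0/r0/mulr_ge0/q0/ltW.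
have eL : e <= c ^+ 2.
  rewrite ler_pdivrMr; last lra.
  by nra.
apply/andP; split => //.
rewrite lerBlDr -lerBlDl gap.
have -> : c * q * r * e = r * c * (q * e) by ring.
have -> : r * c ^+ 3 = r * c * (c ^+ 2) by ring.
by rewrite ler_wpM2l// ?mulr_ge0 ?(ltW c0)//; nra.
Qed.

End ScalarRiccati.

(** * Reduction of the matrix recursion to the scalar one *)

Section SensorSystem.
Variable R : realType.

Lemma ord3_ind (P : 'I_3 -> Prop) : P 0 -> P 1 -> P 2 -> forall i, P i.
Proof.
move=> P0 P1 P2 [[|[|[|//]]] i_lt]; [move: P0|move: P1|move: P2];
  by congr P; apply: val_inj.
Qed.

Lemma sum_ord3 (F : 'I_3 -> R) : \sum_(i < 3) F i = F 0 + F 1 + F 2.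
Proof.
rewrite !big_ord_recr big_ord0 /= add0r.
by congr (F _ + F _ + F _); apply: val_inj.
Qed.

Definition diag_cov (s : R) : 'M[R]_3 :=
  \matrix_(i, j) (if i == j then if i == 0 then s else 1 else 0).

Lemma diag_cov_sym s : (diag_cov s)^T = diag_cov s.
Proof. by apply/matrixP => i j; rewrite !mxE eq_sym; case: eqP => // ->. Qed.

Lemma entry00 n (X : 'M[R]_n.+1) :
  (delta_mx 0 0 *m X *m (delta_mx 0 0)^T : 'M[R]_1) 0 0 = X 0 0.
Proof. by rewrite -rowE trmx_delta -colE !mxE. Qed.

Lemma kalman_step_Aex lam q (C : 'M[R]_(q, 3)) (S : 'M[R]_3) :
  kalman_step (Aex lam) 1%:M C 0 S = diag_cov (1 + lam ^+ 2 * posterior C S 0 0).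
Proof.
have -> : kalman_step (Aex lam) 1%:M C 0 S =
    Aex lam *m posterior C S *m (Aex lam)^T + 1%:M.
  rewrite /kalman_step /posterior addr0 mulmxBr mulmxBl !mulmxA.
  by rewrite addrAC.
apply/matrixP => i j.
have AE k l : Aex lam k l = if (k == l) && (k == 0) then lam else 0 by rewrite mxE.
rewrite mxE [in LHS]mxE; set X := posterior C S.
rewrite [diag_cov _ i j]mxE [1%:M i j]mxE.
rewrite sum_ord3 ![(_ *m X) _ _]mxE !sum_ord3 ![(Aex lam)^T _ _]mxE !AE.
by elim/ord3_ind: i; elim/ord3_ind: j => /=; ring.
Qed.

Lemma iter_kalman_Aex lam q (C : 'M[R]_(q, 3)) (Pi0 : 'M[R]_3) k :
  iter k.+1 (kalman_step (Aex lam) 1%:M C 0) Pi0 =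
  diag_cov (iter k (fun s => 1 + lam ^+ 2 * posterior C (diag_cov s) 0 0)
              (1 + lam ^+ 2 * posterior C Pi0 0 0)).
Proof.
elim: k => [|k IH]; first by rewrite /= kalman_step_Aex.
by rewrite iterS IH kalman_step_Aex.
Qed.

Lemma Vsel0 p (S : {set 'I_p}) : Vsel (0 : 'M[R]_p) S = 0.
Proof. by apply/matrixP => i j; rewrite !mxE. Qed.

(** The first step brings any [Pi0] to the form [diag_cov (u 0)] with [u 0 >= 1]; from there [u]
    follows the Riccati recursion. *)
Lemma trace_Sigma lam p (C : 'M[R]_(p, 3)) (Pi0 : 'M[R]_3) (S : {set 'I_p}) c r L :
  psd Pi0 -> 0 <= c * lam ^+ 2 < 1 -> 0 <= r ->
  (forall s, 1 <= s ->
     posterior (Csel C S) (diag_cov s) 0 0 = c * (s / (1 + r * s))) ->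
  riccati_fixpoint (c * lam ^+ 2) r L ->
  \tr (Sigma (Aex lam) 1%:M C 0 Pi0 S) = 2 + L.
Proof.
move=> Pi0_psd q01 r0 post fixL; case/andP: (q01) => q0 _.
pose u k := iter k (fun s => 1 + lam ^+ 2 * posterior (Csel C S) (diag_cov s) 0 0)
              (1 + lam ^+ 2 * posterior (Csel C S) Pi0 0 0).
have u0 : 1 <= u 0%N.
  rewrite /u /= lerDl mulr_ge0 ?sqr_ge0//.
  by rewrite -entry00; exact: posterior_ge0.
have uS' k : 1 <= u k -> u k.+1 = riccati (c * lam ^+ 2) r (u k).
  by move=> uk; rewrite /u iterS -/(u k) post// /riccati; ring.
have u1 k : 1 <= u k by elim: k => // k IH; rewrite uS'// riccati_ge1.
have u_cvg : u @ \oo --> L by apply: riccati_cvg fixL u0 _ => // k; exact: uS'.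
have entry i j l : (fun k => diag_cov (u k) i j) @ \oo --> l ->
    Sigma (Aex lam) 1%:M C 0 Pi0 S i j = l.
  move=> cvg_l; rewrite mxE Vsel0; apply/cvg_lim => //.
  (* The shift drops the term [Pi0], which need not be diagonal. *)
  rewrite -cvg_shiftS /=; apply: cvg_trans cvg_l; apply: near_eq_cvg.
  by near=> k; rewrite -iterS iter_kalman_Aex.
rewrite /mxtrace sum_ord3 (entry _ _ L) 2?(entry _ _ 1); first ring.
- by under eq_fun do rewrite mxE; exact: cvg_cst.
- by under eq_fun do rewrite mxE; exact: cvg_cst.
- by under eq_fun do rewrite mxE.
Unshelve. all: by end_near. Qed.

(** A gain indexed by all sensors and vanishing off [S] avoids computing with [enum_val]. *)
Lemma posterior_sel p n (C : 'M[R]_(p, n.+1)) (S : {set 'I_p}) (X : 'M[R]_n.+1)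
    (g : 'rV[R]_p) :
  X^T = X -> (forall i, i \notin S -> g 0 i = 0) ->
  (forall i, i \in S -> ((delta_mx 0 0 - g *m C) *m X *m C^T) 0 i = 0) ->
  posterior (Csel C S) X 0 0 = ((delta_mx 0 0 - g *m C) *m X) 0 0.
Proof.
move=> Xsym g_out orth; pose K := \row_(i < #|S|) g 0 (enum_val i).
have KC : K *m Csel C S = g *m C.
  apply/rowP => j; rewrite !mxE.
  rewrite [RHS](bigID (mem S)) /= [X in _ = _ + X]big1 ?addr0; last first.
    by move=> i /g_out ->; rewrite mul0r.
  by rewrite [RHS]big_enum_val; apply: eq_bigr => i _; rewrite !mxE.
rewrite -entry00 (@posterior_gain _ _ _ _ _ _ K)//.
  by rewrite KC trmx_delta -colE mxE.
rewrite KC; apply/rowP => i; have := orth _ (enum_valP i).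
rewrite !mxE => orth_i; rewrite -[RHS]orth_i; apply: eq_bigr => j _.
by rewrite !mxE.
Qed.

Lemma CexE (h : R) :
  ((Cex h 0 0 = 1) * (Cex h 0 1 = h) * (Cex h 0 2 = h)) *
  ((Cex h 1 0 = 1) * (Cex h 1 1 = 0) * (Cex h 1 2 = h)) *
  ((Cex h 2 0 = 0) * (Cex h 2 1 = 1) * (Cex h 2 2 = 1)).
Proof. by do !split; rewrite mxE. Qed.

(** The [z] are the coefficients of the estimation error of the first coordinate; each selected
    sensor imposes one orthogonality equation on them. *)
Lemma posterior_Cex h s (S : {set 'I_3}) (g0 g1 g2 : R) :
  let z0 := 1 - g0 - g1 in
  let z1 := - (g0 * h + g2) in
  let z2 := - (g0 * h + g1 * h + g2) in
  (if 0 \in S then z0 * s + z1 * h + z2 * h = 0 else g0 = 0) ->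
  (if 1 \in S then z0 * s + z2 * h = 0 else g1 = 0) ->
  (if 2 \in S then z1 + z2 = 0 else g2 = 0) ->
  posterior (Csel (Cex h) S) (diag_cov s) 0 0 = z0 * s.
Proof.
move=> z0 z1 z2 c0 c1 c2.
pose g : 'rV[R]_3 := \row_i nth 0 [:: g0; g1; g2] i.
have [gE0 gE1 gE2] : [/\ g 0 0 = g0, g 0 1 = g1 & g 0 2 = g2].
  by split; rewrite mxE.
have zE k : (delta_mx 0 0 - g *m Cex h) 0 k = nth 0 [:: z0; z1; z2] k.
  rewrite mxE [in X in _ + X]mxE mxE [in X in _ - X]mxE sum_ord3 gE0 gE1 gE2.
  by elim/ord3_ind: k; rewrite !CexE /= /z0 /z1 /z2; ring.
have zXE k : ((delta_mx 0 0 - g *m Cex h) *m diag_cov s) 0 k =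
    nth 0 [:: z0 * s; z1; z2] k.
  rewrite mxE sum_ord3 !zE.
  by elim/ord3_ind: k; rewrite !mxE /=; ring.
rewrite (@posterior_sel _ _ _ _ _ g) ?zXE ?diag_cov_sym//.
  by elim/ord3_ind => /negbTE iS; rewrite iS in c0 c1 c2; rewrite ?gE0 ?gE1 ?gE2.
move=> i iS; rewrite mxE sum_ord3 !zXE ![(Cex h)^T _ _]mxE.
move: i iS; elim/ord3_ind => iS; rewrite iS in c0 c1 c2; rewrite !CexE /=.
- by rewrite -[RHS]c0; ring.
- by rewrite -[RHS]c1; ring.
- by rewrite -[RHS]c2; ring.
Qed.

End SensorSystem.

(** * The value of each selection and the greedy choice *)

Section SelectionValue.
Variable R : realType.

(** Indices 0, 1, 2 stand for sensors 1, 2, 3. *)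
Definition post_scale (S : {set 'I_3}) : R := if (0 \in S) && (2 \in S) then 0 else 1.

(** Inverse variance of the disturbance masking [x_1]: [h (x_2 + x_3)] for sensor 1, [h x_3] for
    sensor 2, and [h (x_3 - x_2) / 2] for [y_2 - (h/2) y_3]. *)
Definition post_precision (h : R) (S : {set 'I_3}) : R :=
  if 1 \in S then (if 2 \in S then 2 else 1) / h ^+ 2
  else if 0 \in S then 1 / (2 * h ^+ 2) else 0.

Lemma post_precision_ge0 h S : 0 < h -> 0 <= post_precision h S.
Proof.
move=> h0; have hh : 0 < h ^+ 2 by rewrite exprn_gt0.
rewrite /post_precision; case: ifP => _; case: ifP => _ //.
all: by rewrite divr_ge0//; lra.
Qed.

Lemma posterior_sensors h s S : 0 < h -> 1 <= s ->
  posterior (Csel (Cex h) S) (diag_cov s) 0 0 =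
  post_scale S * (s / (1 + post_precision h S * s)).
Proof.
move=> h0 s1; have hh : 0 < h ^+ 2 by rewrite exprn_gt0.
have h_neq0 : h != 0 by rewrite gt_eqF.
have hs k : 0 <= k -> h ^+ 2 + k * s != 0.
  by move=> k0; rewrite lt0r_neq0// ltr_wpDr// mulr_ge0//; lra.
have hs1 : h ^+ 2 + s != 0 by have := hs 1 ler01; rewrite mul1r.
have hs2 : h ^+ 2 + 2 * s != 0 by rewrite hs.
have hs3 : 2 * h ^+ 2 + s != 0 by rewrite lt0r_neq0//; lra.
rewrite /post_scale /post_precision.
case in0: (0 \in S); case in1: (1 \in S); case in2: (2 \in S); rewrite /= ?mul0r ?mul1r.
(* These gains form [y_1 - h y_3 = x_1], with zero error. *)
- by rewrite (@posterior_Cex _ h s S 1 0 (- h)) ?in0 ?in1 ?in2; ring.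
(* [y_1 - y_2 = h x_2] is uncorrelated with [x_1] and [y_2], so the gain of sensor 2 alone is
   optimal. *)
- by rewrite (@posterior_Cex _ h s S 0 (s / (h ^+ 2 + s)) 0) ?in0 ?in1 ?in2 //; field;
    rewrite ?hs1 ?h_neq0.
- by rewrite (@posterior_Cex _ h s S 1 0 (- h)) ?in0 ?in1 ?in2 //; ring.
- by rewrite (@posterior_Cex _ h s S (s / (2 * h ^+ 2 + s)) 0 0) ?in0 ?in1 ?in2 //; field;
    rewrite ?hs3 ?h_neq0.
(* The scalar gain [s / (s + h^2/2)] applied to [y_2 - (h/2) y_3]. *)
- by rewrite (@posterior_Cex _ h s S 0 (2 * s / (h ^+ 2 + 2 * s)) (- (s * h / (h ^+ 2 + 2 * s))))
    ?in0 ?in1 ?in2 //; field;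
    rewrite ?hs2 ?h_neq0.
- by rewrite (@posterior_Cex _ h s S 0 (s / (h ^+ 2 + s)) 0) ?in0 ?in1 ?in2 //; field;
    rewrite ?hs1 ?h_neq0.
- by rewrite (@posterior_Cex _ h s S 0 0 0) ?in0 ?in1 ?in2 //; field.
- by rewrite (@posterior_Cex _ h s S 0 0 0) ?in0 ?in1 ?in2 //; field.
Qed.

Section FixedInstance.
Variables (lam h : R) (Pi0 : 'M[R]_3).
Hypotheses (lam_lt1 : 0 < `|lam| < 1) (h_gt0 : 0 < h) (Pi0_psd : psd Pi0).

Let f (S : {set 'I_3}) := \tr (Sigma (Aex lam) 1%:M (Cex h) 0 Pi0 S).

Let q_bounds : 0 < lam ^+ 2 < 1.
Proof.
by case/andP: lam_lt1 => l0 l1; rewrite -real_normK ?num_real// exprn_gt0 ?exprn_ilt1.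
Qed.

Lemma trace_fixpoint S : exists L,
  riccati_fixpoint (post_scale S * lam ^+ 2) (post_precision h S) L /\ f S = 2 + L.
Proof.
case/andP: q_bounds => q0 q1.
have q01 : 0 <= post_scale S * lam ^+ 2 < 1.
  rewrite /post_scale; case: ifP => _; first by rewrite mul0r lexx ltr01.
  by rewrite mul1r q1 ltW.
have r0 := post_precision_ge0 S h_gt0.
have [L fixL] := riccati_fixpoint_exists q01 r0; exists L; split=> //.
by apply: trace_Sigma fixL => // s s1; exact: posterior_sensors.
Qed.

Lemma trace_ge3 S : 3 <= f S.
Proof. by have [L [[L1 _] ->]] := trace_fixpoint S; lra. Qed.

(** Sensors 1 and 3 have scale 0, so their fixed point is 1 and the lower bound is attained. *)
Lemma trace_opt S : is_opt f 2 S -> f S = 3.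
Proof.
move=> [_ /(_ [set 0; 2]%SET)]; rewrite cards2 => /(_ isT) f_le.
apply/eqP; rewrite eq_le trace_ge3 andbT (le_trans f_le)//.
have [L [[_]]] := trace_fixpoint [set 0; 2]%SET.
rewrite /post_scale !inE /= mul0r /riccati mul0r addr0 => <- ->.
by lra.
Qed.

Lemma trace_lt S1 S2 : post_scale S1 = 1 -> post_scale S2 = 1 ->
  post_precision h S1 < post_precision h S2 -> f S2 < f S1.
Proof.
move=> c1 c2 r12.
have [L1 [fix1 ->]] := trace_fixpoint S1; have [L2 [fix2 ->]] := trace_fixpoint S2.
rewrite c1 mul1r in fix1; rewrite c2 mul1r in fix2; rewrite ltrD2l.
case/andP: q_bounds => q0 _.
exact: riccati_fixpoint_lt (post_precision_ge0 S1 h_gt0) r12 fix1 fix2.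
Qed.

(** Both rounds have a strict winner by precision, so ties never arise. *)
Lemma greedy_selects S : greedy_output f 2 S -> S = [set 1; 2]%SET.
Proof.
have hh : 0 < h ^+ 2 by rewrite exprn_gt0.
move=> [_ [[_ [-> [j1 [_ [-> min1]]]]] [j2 [j2_new [-> min2]]]]].
have j1E : j1 = 1.
  have := min1 1; rewrite inE => /(_ isT); rewrite leNgt => /negP f_ge.
  move: f_ge {min1 min2 j2_new}; elim/ord3_ind: j1 => //; case; apply: trace_lt;
    rewrite /post_scale /post_precision !inE//=.
  - by rewrite invfM !mul1r gtr_pMl ?invr_gt0//; lra.
  - by rewrite divr_gt0.
rewrite j1E in min2 j2_new *.
(* Next to sensor 2, sensor 1 leaves the precision at [1/h^2] while sensor 3 doubles it. *)
suff -> : j2 = 2 by rewrite finset.setU0 finset.setUC.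
have := min2 2; rewrite !inE => /(_ isT); rewrite leNgt => /negP f_ge.
move: f_ge j2_new {min2}; elim/ord3_ind: j2 => // [|_]; last by rewrite !inE.
case; apply: trace_lt; rewrite /post_scale /post_precision !inE//=.
by rewrite ltr_pM2r ?invr_gt0//; lra.
Qed.

Lemma trace_greedy_bounds S : greedy_output f 2 S ->
  2 + ((1 - lam ^+ 2)^-1 - 2 / h ^+ 2 * (1 - lam ^+ 2)^-1 ^+ 3) <= f S
    <= 2 + (1 - lam ^+ 2)^-1.
Proof.
move=> /greedy_selects ->; have [L [fixL ->]] := trace_fixpoint [set 1; 2]%SET.
have r0 := post_precision_ge0 [set 1; 2]%SET h_gt0.
move: fixL r0; rewrite /post_scale /post_precision !inE /= mul1r => fixL r0.
case/andP: q_bounds => q0 q1; have q01 : 0 <= lam ^+ 2 < 1 by rewrite q1 ltW.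
by rewrite !lerD2l; exact: riccati_fixpoint_near0.
Qed.

End FixedInstance.
End SelectionValue.

(** * The limit of the ratio as [h] tends to infinity *)

Theorem theorem3 (R : realType) (lam : R) (Pi0 : 'M[R]_3)
    (gre opt : R -> {set 'I_3}) :
  0 < `|lam| < 1 ->
  psd Pi0 ->
  (forall h : R, 0 < h ->
     greedy_output (fun S => \tr (Sigma (Aex lam) 1%:M (Cex h) 0 Pi0 S)) 2 (gre h)) ->
  (forall h : R, 0 < h ->
     is_opt (fun S => \tr (Sigma (Aex lam) 1%:M (Cex h) 0 Pi0 S)) 2 (opt h)) ->
  (fun h : R => \tr (Sigma (Aex lam) 1%:M (Cex h) 0 Pi0 (gre h))
                / \tr (Sigma (Aex lam) 1%:M (Cex h) 0 Pi0 (opt h)))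
    @ +oo --> (2 / 3 + 1 / (3 * (1 - lam ^+ 2))).
Proof.
move=> lam01 Pi0_psd greP optP.
have q1 : 1 - lam ^+ 2 != 0.
  case/andP: lam01 => l0 l1.
  by rewrite gt_eqF// subr_gt0 -real_normK ?num_real// exprn_ilt1.
set c := (1 - lam ^+ 2)^-1.
have -> : 2 / 3 + 1 / (3 * (1 - lam ^+ 2)) = (2 + c) / 3 by rewrite /c; field.
(* The optimal trace is exactly 3; the lower bound is polynomial in [h^-1], which tends to 0. *)
apply: (@squeeze_cvgr _ _ _ _
  (fun h => (2 + (c - 2 * (h^-1 * h^-1) * c ^+ 3)) / 3) (fun=> (2 + c) / 3)).
- near=> h; have h0 : 0 < h by near: h; exact: nbhs_pinfty_gt.
  rewrite (trace_opt lam01 h0 Pi0_psd (optP h h0)).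
  have := trace_greedy_bounds lam01 h0 Pi0_psd (greP h h0).
  by rewrite -invfM -expr2 => /andP[lo hi]; rewrite !ler_pM2r ?lo ?hi// invr_gt0.
- have inv_cvg : (fun h : R => h^-1) @ +oo --> (0 : R).
    apply/gtr0_cvgV0; last exact: cvg_id.
    by near=> h; near: h; exact: nbhs_pinfty_gt.
  rewrite [X in _ --> X](_ : _ = (2 + (c - 2 * (0 * 0) * c ^+ 3)) / 3); last by ring.
  apply: cvgMl; apply: cvgD; first exact: cvg_cst.
  apply: cvgB; first exact: cvg_cst.
  by apply: cvgMl; apply: cvgMr; exact: cvgM.
- exact: cvg_cst.
Unshelve. all: by end_near. Qed.
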